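(* Let $p$ be a prime and let $\mathcal{R}_p$ be the set of quadratic residues in $\mathbb{F}_p$. Assume that $\mathcal{A},\mathcal{B}\subseteq\mathbb{F}_p$ satisfy $|\mathcal{A}|,|\mathcal{B}|\geqslant 2$ and $\mathcal{A}+\mathcal{B}=\mathcal{R}_p$. If there exists $\eta\in[0,\frac12)$ such that $\mathfrak{A}(\mathcal{A},\mathcal{B})\leqslant \eta(p-1)$, then \[E(\mathcal{A},\mathcal{B})\geqslant\Big(\frac{1}{2}+\frac{2^{2-4\eta}-2^{3-2\eta}\eta+4\eta-1}{2-4\eta}\Big)(p-1)\] and \[|\mathcal{A}|,|\mathcal{B}|\geqslant \frac{1}{2\cdot 4^\eta}\sqrt{p}.\]
   Context: $\mathcal{R}_p=\{x^2:x\in\mathbb{F}_p^\times\}$. For $\mathcal{A},\mathcal{B}\subseteq\mathbb{F}_p$, $\mathcal{A}+\mathcal{B}=\{a+b:a\in\mathcal{A},b\in\mathcal{B}\}$, $r(x)=|\{(a,b)\in\mathcal{A}\times\mathcal{B}:a+b=x\}|$, $\mathfrak{A}(\mathcal{A},\mathcal{B})=|\{x\in\mathcal{A}+\mathcal{B}: r(x)=1\}|$, and the additive energy is $E(\mathcal{A},\mathcal{B})=|\{(a_1,a_2,b_1,b_2)\in\mathcal{A}\times\mathcal{A}\times\mathcal{B}\times\mathcal{B}:a_1+b_1=a_2+b_2\}|=\sum_{x}r(x)^2$. *)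

(* Defs.v *)
From HB Require Import structures.
From mathcomp Require Import all_boot all_order all_algebra.
Set Implicit Arguments.
Unset Strict Implicit.
Unset Printing Implicit Defensive.
Import GRing.Theory.
Local Open Scope ring_scope.

Section Sumsets.
Variable G : finZmodType.
Implicit Types A B : {set G}.

Definition sumset A B : {set G} := [set a + b | a in A, b in B].

Definition repr_count A B (x : G) : nat :=
  #|[set ab in setX A B | ab.1 + ab.2 == x]|.

Definition unique_sums A B : nat :=
  #|[set x in sumset A B | repr_count A B x == 1%N]|.

(* The quadruple (a1, a2, b1, b2) is encoded as the pair of pairs
   ((a1, a2), (b1, b2)). *)
Definition additive_energy A B : nat :=
  #|[set q in setX (setX A A) (setX B B) |
      q.1.1 + q.2.1 == q.1.2 + q.2.2]|.

End Sumsets.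

(* 'F_p has p elements only when p is prime. *)
Definition quad_residues (p : nat) : {set 'F_p} :=
  [set x ^+ 2 | x : 'F_p & x != 0].

(* Main.v *)
(** In fact [A + B = R_p] forces every [r(x)] on [A + B] to be [1], which
    contradicts [eta < 1/2]; so the hypotheses are never satisfied.
    With [d = (p - 1) / 2], all sums satisfy [(a + b)^d = 1], and the
    Hanson-Petridis form of Stepanov's method gives [|A| |B| <= d]: for
    [A = {a_0, .., a_m}] pick [c] with [\sum_i c_i a_i^j] equal to [0] for
    [j < m] and to [1] for [j = m].  Then [\sum_i c_i (X + a_i)^(m + d) - 1] has
    degree [d] and vanishes to order [m + 1] at every [b] in [B].  As
    [|A + B| = d], the map [A * B -> A + B] is injective. *)

Require Import Defs.
From HB Require Import structures.
From mathcomp Require Import all_boot all_order all_algebra.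
From mathcomp Require Import all_classical all_reals all_analysis.
From mathcomp Require Import finfield lra.
Set Implicit Arguments.
Unset Strict Implicit.
Unset Printing Implicit Defensive.
Import Order.TTheory GRing.Theory Num.Theory.
Local Open Scope ring_scope.

(** Powers of distinct linear factors are coprime, so the divisibilities multiply one root at a
    time. *)
Lemma dvdp_prod_XsubC_exp (F : fieldType) (n : nat) (s : seq F) (q : {poly F}) :
  uniq s -> {in s, forall b, ('X - b%:P) ^+ n %| q} ->
  \prod_(b <- s) ('X - b%:P) ^+ n %| q.
Proof.
elim: s => [|b s IHs] /=; first by rewrite big_nil dvd1p.
case/andP=> bNs uniq_s dvd_s; rewrite big_cons Gauss_dvdp; last first.
  rewrite big_seq; apply: (big_ind (coprimep _)) => [|u v cu cv|e es].
  - exact: coprimep1.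
  - by rewrite coprimepMr cu cv.
  apply/coprimep_expl/coprimep_expr/coprimep_XsubC2.
  by rewrite subr_eq0; apply: contraNneq bNs => <-.
rewrite dvd_s ?mem_head //=; apply: IHs => // e es.
by apply: dvd_s; rewrite inE es orbT.
Qed.

(** Multiplicity is expressed by divisibility instead of derivatives, which keeps the root count
    valid in every characteristic. *)
Lemma leq_size_roots_mult (F : fieldType) (n : nat) (s : seq F) (q : {poly F}) :
  q != 0 -> uniq s -> {in s, forall b, ('X - b%:P) ^+ n %| q} ->
  (n * size s < size q)%N.
Proof.
move=> q0 uniq_s dvd_s.
have := dvdp_leq q0 (dvdp_prod_XsubC_exp uniq_s dvd_s).
rewrite prodrXl polySpred ?monic_neq0 ?monic_exp ?monic_prod_XsubC //.
by rewrite size_exp size_prod_XsubC mulnC.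
Qed.

Lemma coef_XaddC_exp (F : comNzRingType) (a : F) (N k : nat) :
  (('X + a%:P) ^+ N)`_k = a ^+ (N - k) *+ 'C(N, k).
Proof.
rewrite addrC exprDn coef_sum.
under eq_bigr => i _ do rewrite coefMn -polyC_exp coefCM coefXn.
case: (leqP k N) => [kN|Nk]; last first.
  rewrite bin_small // mulr0n big1 // => i _.
  by rewrite gtn_eqF ?mulr0 ?mul0rn //; apply: leq_trans Nk.
rewrite (bigD1 (inord k)) //= inordK // eqxx mulr1 big1 ?addr0 // => i ik.
case: eqP => [ki|_]; last by rewrite mulr0 mul0rn.
by case/eqP: ik; apply: val_inj; rewrite /= inordK.
Qed.

Lemma dvdp_XnP (F : fieldType) (n : nat) (q : {poly F}) :
  (forall k, (k < n)%N -> q`_k = 0) -> 'X^n %| q.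
Proof.
move=> q0; rewrite -(poly_take_drop n q) (_ : take_poly n q = 0).
  by rewrite add0r dvdp_mull.
by apply/polyP=> k; rewrite coef_take_poly coef0; case: ifP => // /q0.
Qed.

(** The conditions on [c] form a square Vandermonde system, invertible because the nodes are
    distinct; [c] is the last column of the inverse. *)
Lemma moment_weights (F : fieldType) (m : nat) (a : 'I_m.+1 -> F) :
  injective a ->
  exists c : 'I_m.+1 -> F,
    forall j, (j <= m)%N -> \sum_i c i * a i ^+ j = (j == m)%:R.
Proof.
move=> a_inj; pose V := Vandermonde m.+1 (\row_i a i).
have V_unit : V \in unitmx.
  rewrite unitmxE det_Vandermonde unitfE.
  apply/prodf_neq0 => i _; apply/prodf_neq0 => j ij; rewrite !mxE subr_eq0.
  by rewrite (inj_eq a_inj) -val_eqE gtn_eqF.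
exists (fun i => (invmx V *m delta_mx ord_max ord0) i (ord0 : 'I_1)) => j jm.
have := congr1 (fun M : 'cV_m.+1 => M (inord j) ord0)
  (mulKVmx V_unit (delta_mx ord_max ord0)).
rewrite [RHS]mxE andbT -val_eqE /= inordK // => <-.
rewrite [RHS]mxE; apply: eq_bigr => i _.
by rewrite !mxE inordK // mulrC.
Qed.

Lemma sum_in_unity_roots (F : fieldType) (m d : nat) (a : 'I_m.+1 -> F)
    (s : seq F) :
  injective a -> uniq s -> (0 < d)%N -> 'C(m + d, d)%:R != 0 :> F ->
  (forall i, {in s, forall b, (a i + b) ^+ d = 1}) ->
  (m.+1 * size s <= d)%N.
Proof.
move=> a_inj uniq_s d_gt0 bin_neq0 ab1.
have [c cP] := moment_weights a_inj.
pose q : {poly F} := \sum_i c i *: ('X + (a i)%:P) ^+ (m + d) - 1.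
have coef_q k : q`_k =
    (\sum_i c i * a i ^+ (m + d - k)) *+ 'C(m + d, k) - (k == 0)%:R.
  rewrite coefB coef1 coef_sum -sumrMnl; congr (_ - _).
  by apply: eq_bigr => i _; rewrite coefZ coef_XaddC_exp mulrnAr.
(* At degree [d] the moment of order [m] appears, so the coefficient is exactly ['C(m + d, d)]; the
   constant [-1] does not interfere since [d > 0]. *)
have q_neq0 : q != 0.
  apply: contraNneq bin_neq0 => q0; have := coef_q d.
  by rewrite q0 coef0 addnK cP // eqxx (gtn_eqF d_gt0) subr0 => <-.
(* Beyond degree [d] the coefficients carry moments of order below [m], which vanish. *)
have size_q : (size q <= d.+1)%N.
  apply/leq_sizeP => k dk; rewrite coef_q gtn_eqF ?subr0; last first.
    exact: leq_trans dk.
  case: (leqP k (m + d)) => [kmd|]; last by move/bin_small->.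
  have lt_m : (m + d - k < m)%N.
    by rewrite ltn_subLR // addnC ltn_add2r.
  by rewrite cP ?(ltnW lt_m) // ltn_eqF // mul0rn.
rewrite -ltnS; apply: leq_trans size_q.
apply: leq_size_roots_mult => // b bs.
(* The moments are unchanged by a shift: in the binomial expansion of [(a i + b) ^+ j] every term
   but [a i ^+ j] carries a moment of order below [m]. *)
have shift_moment j : (j <= m)%N -> \sum_i c i * (a i + b) ^+ j = (j == m)%:R.
  move=> jm; under eq_bigr => i _ do rewrite addrC exprDn big_distrr.
  rewrite exchange_big big_ord_recr /= [X in X + _]big1 ?add0r => [|k _].
    under eq_bigr => i _ do rewrite subnn mul1r binn mulr1n.
    by rewrite cP.
  under eq_bigr => i _ do rewrite mulrnAr mulrCA -mulrnAl.
  rewrite -big_distrr cP /=; last by rewrite (leq_trans _ jm) // ltnW.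
  by rewrite ltn_eqF ?mulr0 // (leq_trans _ jm).
(* Translate [b] to the origin. For [k <= m], the relation [(a i + b) ^+ d = 1] reduces the [k]-th
   coefficient to the shifted moment of order [m - k]: it is 0 for [k > 0], and for [k = 0] it is 1
   and cancels the [-1]. *)
have : 'X^(m.+1) %| q \Po ('X + b%:P).
  apply: dvdp_XnP => k; rewrite ltnS => km.
  have -> : q \Po ('X + b%:P) =
      \sum_i c i *: ('X + (a i + b)%:P) ^+ (m + d) - 1.
    rewrite rmorphB rmorph1 rmorph_sum; congr (_ - _); apply: eq_bigr => i _.
    rewrite /= comp_polyZ rmorphXn rmorphD /= comp_polyX comp_polyC.
    by rewrite polyCD -addrA [b%:P + _]addrC.
  rewrite coefB coef1 coef_sum.
  under eq_bigr => i _.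
    rewrite coefZ coef_XaddC_exp mulrnAr addnC -addnBA // exprD ab1 // mul1r.
    over.
  rewrite sumrMnl shift_moment ?leq_subr //.
  case: k km => [|k] km; first by rewrite subn0 eqxx bin0 subrr.
  by rewrite ltn_eqF ?mul0rn ?subr0 // ltn_subrL (leq_trans _ km).
move/(dvdp_comp_poly ('X - b%:P)).
by rewrite comp_polyXaddC_K rmorphXn /= comp_polyX.
Qed.

Lemma binomial_Fp_neq0 (p n k : nat) :
  prime p -> (k <= n < p)%N -> 'C(n, k)%:R != 0 :> 'F_p.
Proof.
move=> p_pr /andP[kn np]; rewrite -(dvdn_pcharf (pchar_Fp p_pr)).
have : ~~ (p %| n`!)%N.
  elim: n np {kn} => [|n IHn] np; first by rewrite fact0 dvdn1 gtn_eqF ?prime_gt1.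
  by rewrite factS Euclid_dvdM // negb_or gtnNdvd // IHn // ltnW.
by apply: contra => pC; rewrite -(bin_fact kn) dvdn_mulr.
Qed.

Lemma leq_card_sumset (G : finZmodType) (A B : {set G}) :
  (0 < #|B|)%N -> (#|A| <= #|sumset A B|)%N.
Proof.
case/card_gt0P=> b bB; rewrite -(card_imset (mem A) (addIr b)).
by apply/subset_leq_card/fintype.subsetP => _ /imsetP[a aA ->]; apply/imset2P; exists a b.
Qed.

(** Addition maps [A * B] onto the sumset; a surjection onto a set at least as large as its source
    is injective. *)
Lemma unique_sums_eq_card (G : finZmodType) (A B : {set G}) :
  (#|A| * #|B| <= #|sumset A B|)%N -> unique_sums A B = #|sumset A B|.
Proof.
rewrite -cardsX {1}/sumset curry_imset2X => card_le.
have sum_inj : {in finset.setX A B &, injective (uncurry (+%R : G -> G -> G))}.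
  by apply/imset_injP; rewrite eqn_leq leq_imset_card.
congr #|pred_of_set _|; apply/setP=> x; rewrite inE andb_idr //.
case/imset2P=> a b aA bB ->; apply/cards1P; exists (a, b); apply/setP=> ab.
rewrite !inE; apply/andP/eqP => [[abAB /eqP ab_sum]|->]; last by rewrite aA bB.
by apply: sum_inj; rewrite ?inE ?aA //=; case: ab ab_sum abAB.
Qed.

Lemma quad_residuesP (p : nat) (y : 'F_p) :
  prime p -> odd p -> y \in quad_residues p -> y ^+ p./2 = 1.
Proof.
move=> p_pr p_odd /imsetP[x]; rewrite inE => x0 ->; rewrite -exprM mul2n.
(* Multiplying by [x] turns the claim into Fermat's [x ^+ p = x], as [p] is odd. *)
apply: (mulfI x0); rewrite mulr1 -exprS -[RHS]expf_card card_Fp //.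
by congr (_ ^+ _); rewrite -[RHS]odd_double_half p_odd.
Qed.

(** Each fibre of squaring on the nonzero elements lies in some [[set x; - x]]. *)
Lemma card_quad_residues_ge (p : nat) :
  prime p -> (p.-1 <= #|quad_residues p|.*2)%N.
Proof.
move=> p_pr; rewrite -[in p.-1](card_Fp p_pr) (cardD1 0) /= -sum1_card.
rewrite (partition_big (fun x : 'F_p => x ^+ 2) (mem (quad_residues p))) /=; last first.
  by move=> x; rewrite !inE andbT => x0; apply/imsetP; exists x; rewrite ?inE.
rewrite -muln2 -sum_nat_const; apply: leq_sum => y /imsetP[x _ ->].
rewrite sum1_card; apply: leq_trans (_ : #|[set x; - x]| <= 2)%N; last first.
  by rewrite cards2; case: (_ != _).
apply/subset_leq_card/fintype.subsetP => z.
by rewrite !inE unfold_in /= eqf_sqr => /andP[].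
Qed.

Lemma card_sumset_quad_residues (p : nat) (A B : {set 'F_p}) :
  prime p -> (2 <= #|A|)%N -> (0 < #|B|)%N -> sumset A B = quad_residues p ->
  (#|A| * #|B| <= #|quad_residues p|)%N.
Proof.
move=> p_pr hA hB hAB.
have card_Q : (#|quad_residues p| <= p.-1)%N.
  rewrite -[in p.-1](card_Fp p_pr) [#|'F_p|](cardD1 0) /=.
  apply: (leq_trans (leq_imset_card _ _)).
  by apply/subset_leq_card/fintype.subsetP => x; rewrite !inE => ->.
have := leq_card_sumset A hB; rewrite hAB => AQ.
(* For [p = 2] there is at most one residue, too few for [2 <= #|A|]. *)
have [p2|p_odd] := even_prime p_pr.
  have p1 : p.-1 = 1%N by rewrite p2.
  by move: (leq_trans hA (leq_trans AQ card_Q)); rewrite p1.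
have p_eq : p = p./2.*2.+1 by rewrite -[LHS]odd_double_half p_odd.
have d_gt0 : (0 < p./2)%N by case: (p./2) p_eq (prime_gt1 p_pr) => [->|].
(* The case [m = 0] with the single shift 0: the residues are among the at most [p./2] roots of
   [X^(p./2) - 1]. *)
have card_Qd : (#|quad_residues p| <= p./2)%N.
  rewrite -[leqLHS]mul1n cardE.
  apply: (@sum_in_unity_roots _ 0 _ (fun=> 0)) => //.
  - by move=> i j _; rewrite !ord1.
  - exact: enum_uniq.
  - by rewrite add0n binn oner_eq0.
  - by move=> _ y; rewrite mem_enum add0r; apply: quad_residuesP.
suff : (#|A| * #|B| <= p./2)%N.
  move/leq_trans; apply.
  by rewrite -leq_double (leq_trans _ (card_quad_residues_ge p_pr)) // {2}p_eq.
case EA : #|A| hA AQ => [|m] // _ AQ; rewrite [#|B|]cardE.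
have mA (i : 'I_m.+1) : (i < #|A|)%N by rewrite EA.
apply: (@sum_in_unity_roots _ _ _ (fun i => enum_val (Ordinal (mA i)))) => //.
- by move=> i j /enum_val_inj/(congr1 val)/= /val_inj.
- exact: enum_uniq.
(* Since [m < #|A| <= #|quad_residues p| <= p./2], the upper index [m + p./2] stays below [p]. *)
- apply: binomial_Fp_neq0 => //; rewrite leq_addl /= {2}p_eq ltnS -addnn leq_add2r.
  exact: leq_trans (ltnW AQ) card_Qd.
- move=> i b; rewrite mem_enum => bB; apply: quad_residuesP => //.
  by rewrite -hAB; apply/imset2P; exists (enum_val (Ordinal (mA i))) b;
    rewrite ?enum_valP.
Qed.

Theorem theorem1p3 (R : realType) (p : nat) (hp : prime p)
    (A B : {set 'F_p}) (hA : (2 <= #|A|)%N) (hB : (2 <= #|B|)%N)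
    (hAB : sumset A B = quad_residues p)
    (eta : R) (heta0 : 0 <= eta) (heta1 : eta < 1 / 2)
    (hU : (unique_sums A B)%:R <= eta * (p%:R - 1)) :
  (1 / 2 + (2 `^ (2 - 4 * eta) - 2 `^ (3 - 2 * eta) * eta + 4 * eta - 1)
             / (2 - 4 * eta)) * (p%:R - 1)
    <= (additive_energy A B)%:R
  /\ 1 / (2 * 4 `^ eta) * Num.sqrt p%:R <= #|A|%:R
  /\ 1 / (2 * 4 `^ eta) * Num.sqrt p%:R <= #|B|%:R.
Proof.
have card_AB := card_sumset_quad_residues hp hA (ltnW hB) hAB.
have p_gt1 : 1 < p%:R :> R by rewrite ltr1n prime_gt1.
suff : eta * (p%:R - 1) < (unique_sums A B)%:R by rewrite ltNge hU.
rewrite unique_sums_eq_card ?hAB //.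
have : p%:R - 1 <= 2 * #|quad_residues p|%:R :> R.
  rewrite -[1](mulr1n 1) -natrB ?prime_gt0 // -natrM ler_nat subn1 mul2n.
  exact: card_quad_residues_ge.
(* Multiply [eta < 1 / 2] by [p - 1 > 0]. *)
by nra.
Qed.
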